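(* There exists a graph on nine vertices such that it is not possible to construct a spectral graph drawing based on the Laplacian matrix in a radical computation tree. For this graph there exists a dense subset $A$ of $\mathbf{Q}$ such that it is not possible to construct a spectral graph drawing based on the relaxed Laplacian with $\rho\in A$ in a radical computation tree.
   Context: For a graph $G$: adjacency matrix $A$ ($A_{ij}=1$ iff $ij$ is an edge), degree matrix $D$ (diagonal, $D_{ii}=\deg(v_i)$), Laplacian $L=D-A$, relaxed Laplacian $L-\rho D$ with parameter $\rho$. A spectral graph drawing based on a matrix $M$ takes eigenvectors $u_1,\dots,u_n$ of $M$ ordered by eigenvalue, chooses two of them $u_r,u_s$ with $r\neq s$, and places vertex $i$ at $(u_r[i],u_s[i])$. An algebraic computation tree is a rooted tree whose computation nodes compute a value as the sum, difference, product or quotient of integer constants and values computed at ancestor nodes, and whose decision nodes test whether a computed value is greater than zero and branch. A radical computation tree additionally allows computing the $k$-th root of a previously computed value ($k$ an integer parameter) and complex conjugation. *)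

(* Defs.v *)
(* Complex numbers are modelled by algC (algebraic complex
   numbers, a numClosedFieldType with conjugation ^* and k-th roots n.-root). *)
From HB Require Import structures.
From mathcomp Require Import all_boot all_order all_algebra all_field.
Set Implicit Arguments. Unset Strict Implicit. Unset Printing Implicit Defensive.
Import Order.TTheory GRing.Theory Num.Theory.
Local Open Scope ring_scope.

(* ---------- Graphs ---------- *)
(* A (finite simple) graph on vertex set 'I_n: symmetric irreflexive relation. *)
Definition simple_graph (n : nat) (e : rel 'I_n) : Prop :=
  symmetric e /\ irreflexive e.

Definition adjacency (n : nat) (e : rel 'I_n) : 'M[algC]_n :=
  \matrix_(i, j) ((e i j : nat)%:R).

Definition degree_mx (n : nat) (e : rel 'I_n) : 'M[algC]_n :=
  diag_mx (\row_i (#|[set j | e i j]|%:R)).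

Definition laplacian (n : nat) (e : rel 'I_n) : 'M[algC]_n :=
  degree_mx e - adjacency e.

Definition relaxed_laplacian (n : nat) (e : rel 'I_n) (rho : rat) : 'M[algC]_n :=
  laplacian e - ratr rho *: degree_mx e.

(* ---------- Spectral graph drawings ---------- *)
(* A spectral drawing based on M: an eigenbasis u_1..u_n of M (the columns of
   the invertible real matrix U), ordered by (real) eigenvalue, two distinct
   indices r <> s, and vertex i placed at (u_r[i], u_s[i]). *)
Definition spectral_drawing (n : nat) (M : 'M[algC]_n)
    (pos : seq (algC * algC)) : Prop :=
  exists (U : 'M[algC]_n) (lam : 'I_n -> algC) (r s : 'I_n),
    U \in unitmx /\
    (forall i k, U i k \is Num.real) /\
    (forall k, lam k \is Num.real) /\
    (forall k l : 'I_n, (k <= l)%N -> lam k <= lam l) /\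
    (forall k, M *m col k U = lam k *: col k U) /\
    r != s /\
    pos = [seq (U i r, U i s) | i <- enum 'I_n].

(* ---------- Radical computation trees ---------- *)
(* Computed values are stored in a list in the order they are computed along
   the current root-to-node path (initially the input values); a value is
   referred to by its index in that list (ancestors only). *)
Inductive operand := OConst of int | OVal of nat.
Inductive arith_op := OpAdd | OpSub | OpMul | OpDiv.

Inductive rtree :=
| RLeaf of seq (nat * nat)          (* output: vertex i at (v_a, v_b) *)
| RArith of arith_op & operand & operand & rtree
| RRoot of nat & nat & rtree          (* RRoot k a t : (k+1)-th root of v_a *)
| RConj of nat & rtree                (* complex conjugate of v_a *)
| RTest of nat & rtree & rtree.       (* if v_a > 0 then left else right *)

Definition operand_val (vs : seq algC) (o : operand) : algC :=
  match o with OConst z => z%:~R | OVal a => nth 0 vs a end.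

Definition arith_val (o : arith_op) (x y : algC) : algC :=
  match o with OpAdd => x + y | OpSub => x - y | OpMul => x * y | OpDiv => x / y end.

Fixpoint rt_eval (vs : seq algC) (t : rtree) : seq (algC * algC) :=
  match t with
  | RLeaf out => [seq (nth 0 vs p.1, nth 0 vs p.2) | p <- out]
  | RArith o a b t' => rt_eval (rcons vs (arith_val o (operand_val vs a) (operand_val vs b))) t'
  | RRoot k a t' => rt_eval (rcons vs (k.+1.-root (nth 0 vs a))) t'
  | RConj a t' => rt_eval (rcons vs (nth 0 vs a)^*) t'
  | RTest a t1 t2 => if 0 < nth 0 vs a then rt_eval vs t1 else rt_eval vs t2
  end.

(* Input of the tree: the adjacency matrix entries, row by row. *)
Definition adj_input (n : nat) (e : rel 'I_n) : seq algC :=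
  [seq (e i j : nat)%:R | i <- enum 'I_n, j <- enum 'I_n].

(* The tree t, run on input inp, constructs a spectral drawing based on M. *)
Definition constructs_drawing (n : nat) (inp : seq algC) (M : 'M[algC]_n)
    (t : rtree) : Prop :=
  spectral_drawing M (rt_eval inp t).

Definition dense_in_Q (A : rat -> Prop) : Prop :=
  forall x y : rat, x < y -> exists z, A z /\ x < z /\ z < y.

(* Main.v *)
(** The graph is the path 0 - 1 - ... - 8 with the extra edge {5, 7}.  Modulo 5
   the characteristic polynomial of its Laplacian L splits into distinct
   irreducible factors of degrees 1, 1, 7, and modulo 7 into distinct factors of
   degrees 1, 3, 5.  For rho = 35 a / (1 + 35 c) the matrix
   (1 + 35 c) (L - rho D) is an integer matrix congruent to L modulo 35, so all
   these matrices (rho = 0 included) are treated at once.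

   The automorphisms of the algebraic numbers permute the eigenvalues of such a
   matrix; let G in S_9 be the group of these permutations.  Frobenius elements
   at 5 and 7 give elements of G whose orders are divisible by 7 and by 15.
   Hence G is not solvable (a Hall {5, 7}-subgroup would have order 35, hence
   be cyclic, but S_9 has no element of order 35), and a normal subgroup of G
   fixing two points is trivial.

   A number computed by a radical computation tree is fixed by some derived
   subgroup of the automorphism group, since commutators of automorphisms fix the
   roots of unity, and commutators of those fix the n-th roots of the numbers
   fixed so far.  The eigenvalues belonging to the two coordinates of a drawing
   made of such numbers would be fixed as well; so would be, by the above, all
   the eigenvalues, and G would be solvable. *)
From HB Require Import structures.
From mathcomp Require Import all_boot all_order all_fingroup all_algebra.
From mathcomp Require Import all_solvable all_field.
From mathcomp Require Import boolp zify ring lra.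
From mathcomp Require classical_sets.
Require Import Defs.

Set Implicit Arguments.
Unset Strict Implicit.
Unset Printing Implicit Defensive.

(** * Subgroups of S_9 *)

Section SubgroupsS9.
Local Open Scope group_scope.

(** With [m] the product of the orbit sizes, [s ^+ m = 1]; so [p] divides [m] and, being prime, one
    of its factors. *)
Lemma prime_dvdn_porbit (T : finType) (s : {perm T}) p :
  prime p -> p %| #[s] -> exists x, p %| #|porbit s x|.
Proof.
move=> p_pr ps; pose m := (\prod_x #|porbit s x|)%N.
have : s ^+ m = 1.
  apply/permP => x; rewrite perm1 permX.
  have /dvdnP[d ->] : #|porbit s x| %| m by rewrite /m (bigD1 x) //= dvdn_mulr.
  elim: d => [|d IHd] //; rewrite mulSn addnC iterD.
  by rewrite iter_porbit.
move/eqP; rewrite -order_dvdn => /(dvdn_trans ps).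
rewrite /m; elim/big_rec: _ => [|x q _ IHq]; first by rewrite Euclid_dvd1.
by rewrite Euclid_dvdM // => /orP[xp|/IHq//]; exists x.
Qed.

Lemma porbit_closed (T : finType) (s : {perm T}) (S : {set T}) x :
  (forall y, y \in S -> s y \in S) -> x \in S -> porbit s x \subset S.
Proof.
move=> sS xS; apply/subsetP => y /porbitP[i ->].
by elim: i => [|i IHi]; rewrite ?expg0 ?perm1 // expgSr permM sS.
Qed.

Lemma disjoint_porbits (T : finType) (s : {perm T}) x y :
  #|porbit s x| != #|porbit s y| -> #|porbit s x| + #|porbit s y| <= #|T|.
Proof.
move=> neq; rewrite -cardsUI; suff -> : porbit s x :&: porbit s y = set0.
  by rewrite cards0 addn0 max_card.
apply/setP => z; rewrite !inE; apply/andP => -[].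
by rewrite -!eq_porbit_mem => /eqP zx /eqP zy; rewrite -zx -zy eqxx in neq.
Qed.

(** The only positive multiple of 5 up to 9 is 5. The orbit whose size is a multiple of 3 is then a
    different one, with only 4 points left for it. *)
Lemma porbits_of_order15 (t : 'S_9) : 15 %| #[t] ->
  exists x y, #|porbit t x| = 5 /\ #|porbit t y| = 3.
Proof.
move=> t15; have [x x5] : exists x, 5 %| #|porbit t x|.
  by apply: prime_dvdn_porbit => //; apply: dvdn_trans t15.
have [y y3] : exists x, 3 %| #|porbit t x|.
  by apply: prime_dvdn_porbit => //; apply: dvdn_trans t15.
exists x, y; move: (disjoint_porbits (s := t) (x := x) (y := y)).
have [x_gt0 y_gt0] : 0 < #|porbit t x| /\ 0 < #|porbit t y|.
  by rewrite !card_gt0; split; apply/set0Pn; eexists; apply: porbit_id.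
move: x5 y3 x_gt0 y_gt0 (max_card (porbit t x)) (max_card (porbit t y)).
rewrite card_ord => /dvdnP[a ->] /dvdnP[b ->].
case: a => [|[|a]] // _; case: b => [|[|[|[|b]]]] // _ _ _ h; try by [].
all: by have := h isT.
Qed.

(* [s] has a 7-cycle and [t] a 5-cycle and a 3-cycle; a stable set of size 7
   and its complement of size 2 cannot both be unions of cycles of [t]. *)
Lemma stable_set_large (s t : 'S_9) (S : {set 'I_9}) :
    7 %| #[s] -> 15 %| #[t] -> 1 < #|S| ->
    (forall x, x \in S -> s x \in S) -> (forall x, x \in S -> t x \in S) ->
  8 <= #|S|.
Proof.
move=> s7 t15 S2 sS tS.
have stableC (u : 'S_9) : (forall x, x \in S -> u x \in S) ->
    forall x, x \in ~: S -> u x \in ~: S.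
  move=> uS x; rewrite !inE; apply: contra => uxS.
  have : porbit u x \subset S.
    by rewrite -(porbit_perm u 1) expg1; apply: porbit_closed.
  by move/subsetP; apply; apply: porbit_id.
have orbS (u : 'S_9) x : (forall x, x \in S -> u x \in S) ->
    porbit u x \subset S \/ porbit u x \subset ~: S.
  move=> uS; have [xS|xS] := boolP (x \in S); [left|right];
    apply: porbit_closed => //.
    exact: stableC.
  by rewrite inE.
have [x x7] := prime_dvdn_porbit (isT : prime 7) s7.
have [y [z [y5 z3]]] := porbits_of_order15 t15.
have {}x7 : 7 <= #|porbit s x|.
  by apply: dvdn_leq x7; rewrite card_gt0; apply/set0Pn; exists x; apply: porbit_id.
have := cardsC S; rewrite card_ord.
have yz0 : #|porbit t y :|: porbit t z| = 8.
  rewrite cardsU y5 z3; suff -> : porbit t y :&: porbit t z = set0 by rewrite cards0.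
  apply/setP => w; rewrite !inE; apply/andP => -[].
  by rewrite -!eq_porbit_mem => /eqP yw /eqP zw; rewrite -yw zw z3 in y5.
have bound (A B : {set 'I_9}) m : m <= #|A| -> A \subset B -> m <= #|B|.
  by move=> mA /subset_leq_card; apply: leq_trans.
have bound8 (A : {set 'I_9}) :
    porbit t y \subset A -> porbit t z \subset A -> 8 <= #|A|.
  by move=> yA zA; apply: (bound _ _ _ (eq_leq (esym yz0))); rewrite subUset yA.
(* Each orbit lies in [S] or in its complement. If both orbits of [t] lie in [S], it has 8 points;
   every other distribution contradicts the cardinalities. *)
case: (orbS t y tS) => yS; case: (orbS t z tS) => zS; case: (orbS s x sS) => xS.
all: have := bound _ _ _ x7 xS.
all: have := bound _ _ 5 _ yS; rewrite y5 => /(_ isT).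
all: have := bound _ _ 3 _ zS; rewrite z3 => /(_ isT).
all: try (have := bound8 _ yS zS); lia.
Qed.

(** By normality the common fixed points of [N] form a set stable under [G]. At most one point
    remains outside it, and a permutation fixing all the others fixes that one too. *)
Lemma normal_fix2_trivial (G N : {group 'S_9}) s t a b :
    s \in G -> t \in G -> 7 %| #[s] -> 15 %| #[t] -> N <| G ->
    a != b -> (forall u, u \in N -> u a = a /\ u b = b) ->
  N :=: 1.
Proof.
move=> Gs Gt s7 t15 nNG ab fixab.
pose S := [set x | [forall u in N, (u : 'S_9) x == x]].
have SP x u : x \in S -> u \in N -> u x = x.
  by rewrite inE => /forall_inP xS /xS/eqP.
have GS (g : 'S_9) : g \in G -> forall x, x \in S -> g x \in S.
  move=> Gg x xS; rewrite inE; apply/forall_inP => u Nu; apply/eqP.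
  have : u ^ g^-1 \in N by rewrite memJ_norm // (subsetP (normal_norm nNG)) ?groupV.
  move/(SP x _ xS); rewrite /conjg invgK !permM => /(congr1 g).
  by rewrite permKV.
have S2 : 1 < #|S|.
  have ab2 : 1 < #|[set a; b]| by rewrite cards2 ab.
  apply: (leq_trans ab2); apply: subset_leq_card.
  apply/subsetP => x /set2P[] ->; rewrite inE;
  by apply/forall_inP => u /fixab[/eqP ? /eqP].
have := stable_set_large s7 t15 S2 (GS s Gs) (GS t Gt) => S8.
have SC : #|~: S| <= 1 by have := cardsC S; rewrite card_ord; lia.
apply/trivgP/subsetP => u Nu; rewrite inE; apply/eqP/permP => x; rewrite perm1.
have [xS|xS] := boolP (x \in S); first exact: SP.
have uxS : u x \in ~: S.
  rewrite inE; apply: contra xS => /(GS u^-1 _) .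
  rewrite permK; apply; rewrite groupV; exact: (subsetP (normal_sub nNG)).
have xSC : x \in ~: S by rewrite inE.
exact: (card_le1_eqP SC).
Qed.

(** The only divisor of 35 congruent to 1 modulo 5, or modulo 7, is 1, so both Sylow subgroups are
    normal. Their generators commute, and the product of these has order 35. *)
Lemma order35_cyclic (gT : finGroupType) (H : {group gT}) : #|H| = 35 ->
  exists2 z, z \in H & #[z] = 35.
Proof.
move=> cH; have normal_Sylow p : p \in [:: 5; 7] ->
    exists2 P : {group gT}, p.-Sylow(H) P & P <| H.
  move=> p57; apply/normal_sylowP.
  have p_pr : prime p by move: p57; rewrite !inE => /orP[]/eqP->.
  have := card_Syl_mod H p_pr; have := card_Syl_dvd p H; rewrite cH dvdn_divisors //.
  by move: p57; rewrite !inE => /orP[]/eqP-> /or4P[]/eqP->.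
have [P sylP nP] := normal_Sylow 5 isT; have [Q sylQ nQ] := normal_Sylow 7 isT.
have cP : #|P| = 5 by rewrite (card_Hall sylP) cH p_part.
have cQ : #|Q| = 7 by rewrite (card_Hall sylQ) cH p_part.
have [x defP] := cyclicP (prime_cyclic (etrans (congr1 _ cP) isT)).
have [y defQ] := cyclicP (prime_cyclic (etrans (congr1 _ cQ) isT)).
have Hx : x \in H by rewrite (subsetP (normal_sub nP)) // defP cycle_id.
have Hy : y \in H by rewrite (subsetP (normal_sub nQ)) // defQ cycle_id.
have tiPQ : P :&: Q = 1 by apply: coprime_TIg; rewrite cP cQ.
have cxy : commute x y.
  apply/commgP; have : [~ x, y] \in P :&: Q.
    rewrite inE; apply/andP; split.
      rewrite commgEl groupM ?groupV ?memJ_norm ?(subsetP (normal_norm nP)) //.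
        by rewrite defP cycle_id.
      by rewrite defP cycle_id.
    rewrite commgEr groupM ?memJ_norm ?groupV ?(subsetP (normal_norm nQ)) //;
    by rewrite defQ cycle_id.
  by rewrite tiPQ inE.
exists (x * y); first by rewrite groupM.
by rewrite orderM //= /order -defP -defQ cP cQ.
Qed.

(** Disjoint orbits of sizes divisible by 5 and by 7 need 12 points. *)
Lemma no_order35 (z : 'S_9) : #[z] != 35.
Proof.
apply/eqP => z35; have [d5 d7] : 5 %| #[z] /\ 7 %| #[z] by rewrite z35.
have [x x5] := prime_dvdn_porbit (isT : prime 5) d5.
have [y y7] := prime_dvdn_porbit (isT : prime 7) d7.
move: (disjoint_porbits (s := z) (x := x) (y := y)).
have [x_gt0 y_gt0] : 0 < #|porbit z x| /\ 0 < #|porbit z y|.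
  by rewrite !card_gt0; split; apply/set0Pn; eexists; apply: porbit_id.
move: x5 y7 x_gt0 y_gt0 (max_card (porbit z x)) (max_card (porbit z y)).
rewrite card_ord; lia.
Qed.

Lemma not_solvable_order35 (G : {group 'S_9}) s t :
  s \in G -> t \in G -> 7 %| #[s] -> 15 %| #[t] -> ~~ solvable G.
Proof.
move=> Gs Gt s7 t15; apply/negP => /(Hall_exists (pred2 5 7 : nat_pred))[H hallH].
have sHG := pHall_sub hallH.
have cG9 : #|G| %| 9`!.
  by have := cardSg (subsetT G); rewrite cardsT card_Sn.
have [G7 G5] : 7 %| #|G| /\ 5 %| #|G|.
  split; first exact: dvdn_trans s7 (order_dvdG Gs).
  by apply: dvdn_trans (order_dvdG Gt); apply: dvdn_trans t15.
have cH : #|H| = 35.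
  have piH : (pred2 5 7 : nat_pred).-nat #|H| by case/andP: hallH => _ /andP[].
  apply/eqP; rewrite eqn_dvd; apply/andP; split.
    (* Since 5 and 7 divide [9!] only once, the order of the Hall subgroup divides 35. *)
    have def9 : 9`! = (35 * (2 ^ 7 * 3 ^ 4))%N.
      by rewrite -[(2 ^ 7)%N]/128 -[(3 ^ 4)%N]/81 !factS fact0; lia.
    rewrite -(@Gauss_dvdl _ _ (2 ^ 7 * 3 ^ 4)%N) -?def9.
      by apply: dvdn_trans cG9; rewrite cardSg.
    by apply: pnat_coprime piH _; rewrite pnatM !pnatX !pnatE.
  have pi35 : (pred2 5 7 : nat_pred).-nat 35.
    by rewrite -[35]/(5 * 7)%N pnatM !pnatE.
  rewrite (card_Hall hallH) -(part_pnat_id pi35) partn_dvd //.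
  by rewrite -[35]/(5 * 7)%N Gauss_dvd ?G5.
have [z _ /eqP] := order35_cyclic cH; exact/negP/no_order35.
Qed.

End SubgroupsS9.

Import Order.TTheory GRing.Theory Num.Theory.
Local Open Scope ring_scope.

(** * Frobenius elements *)

Section ResidueField.
Local Open Scope quotient_scope.
Variables (R : comNzRingType) (a : R).
Hypothesis a_nonunit : forall x, x * a != 1.

Definition proper_ideal_over (I : {pred R}) := idealr_closed I /\ a \in I.

Lemma maximal_ideal_over : exists I : {pred R}, proper_ideal_over I /\
  forall J : {pred R}, proper_ideal_over J -> {subset I <= J} -> {subset J <= I}.
Proof.
pose T := {I : R -> bool | proper_ideal_over I}.
have aP : proper_ideal_over (fun x => `[< exists y, x = y * a >]).
  split; last by apply/asboolP; exists 1; rewrite mul1r.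
  split; first by apply/asboolP; exists 0; rewrite mul0r.
    by apply/asboolPn => -[y /eqP]; rewrite eq_sym (negPf (a_nonunit y)).
  move=> b x y /asboolP[x' ->] /asboolP[y' ->]; apply/asboolP.
  by exists (b * x' + y'); rewrite mulrDl mulrA.
pose sub (I J : T) := `[< {subset sval I <= sval J} >].
have subxx I : sub I I by apply/asboolP.
have sub_trans I J K : sub I J -> sub J K -> sub I K.
  by move=> /asboolP IJ /asboolP JK; apply/asboolP=> x /IJ /JK.
pose t0 : T := exist _ _ aP.
have [C totC|I maxI] := @classical_sets.ZL_preorder T t0 sub subxx sub_trans.
  (* An empty chain is bounded by the principal ideal [t0], a nonempty one by its union [J]. *)
  have [[I0 CI0]|C0] := pselect (exists I, C I); last first.
    by exists t0 => I CI; case: C0; exists I.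
  have CP I : C I -> proper_ideal_over (sval I) by move=> _; exact: (svalP I).
  pose J := fun x => `[< exists2 I, C I & x \in sval I >].
  have JP : proper_ideal_over J.
    split; last by apply/asboolP; exists I0 => //; have [] := CP _ CI0.
    split; first by apply/asboolP; exists I0 => //; have [[]] := CP _ CI0.
      by apply/asboolPn => -[I /CP[[_ /negP I1 _] _]].
    move=> b x y /asboolP[I1 CI1 xI1] /asboolP[I2 CI2 yI2]; apply/asboolP.
    have [/asboolP I12|/asboolP I21] := totC _ _ CI1 CI2.
      by exists I2 => //; have [[_ _ ->//]] := CP _ CI2; apply: I12.
    by exists I1 => //; have [[_ _ ->//]] := CP _ CI1; apply: I21.
  exists (exist _ J JP) => I CI; apply/asboolP => x xI /=.
  by apply/asboolP; exists I.
exists (sval I); split; first exact: (svalP I).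
move=> J PJ IJ; apply/asboolP.
exact: (maxI (exist _ (J : R -> bool) PJ) (asboolT IJ)).
Qed.

Lemma residue_field :
  exists (k : fieldType) (phi : {rmorphism R -> k}), phi a = 0.
Proof.
have [I [[idI aI] maxI]] := maximal_ideal_over.
pose J : idealr R := HB.pack (I : R -> bool) (isIdealr.Build R I idI).
pose Q := {ideal_quot J}.
have piE (x : R) : (\pi_Q x == 0 :> Q) = (x \in I).
  have -> : (x \in I) = (x - 0 \in J) by rewrite subr0.
  by rewrite Quotient.idealrBE (rmorph0 \pi_Q).
have invP (z : Q) : exists y : Q, (z != 0) ==> (y * z == 1).
  elim/quotW: z => x; case: (boolP (x \in I)) => xI.
    by exists 0; rewrite piE xI.
  (* [K] is the sum of [I] and the multiples of [x]. Either it contains 1, which gives an inverse of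
     [x] modulo [I], or it is proper, against the maximality of [I]. *)
  pose K := fun y => `[< exists b, y - b * x \in I >].
  have [I0 I1 IM] := idI.
  have xK : x \in K by apply/asboolP; exists 1; rewrite mul1r subrr.
  have subIK : {subset I <= K}.
    by move=> y yI; apply/asboolP; exists 0; rewrite mul0r subr0.
  have [/asboolP[b Ib]|K1] := boolP (1 \in K).
    exists (\pi_Q b); apply/implyP => _; rewrite -rmorphM eq_sym.
    by rewrite -(rmorph1 \pi_Q) -subr_eq0 -rmorphB piE.
  suff /maxI/(_ subIK)/(_ x xK) : proper_ideal_over K by rewrite (negPf xI).
  split; last exact: subIK.
  split=> // [|c u v /asboolP[d Id] /asboolP[e Ie]]; first exact: subIK.
  apply/asboolP; exists (c * d + e).
  by rewrite mulrDl opprD addrACA -mulrA -mulrBr IM.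
pose inv (z : Q) : Q := if z == 0 then 0 else sval (cid (invP z)).
have mulVq (z : Q) : z != 0 -> inv z * z = 1.
  move=> z0; rewrite /inv ifN //; case: cid => y /= /implyP yz.
  exact/eqP/yz.
have inv0 : inv 0 = 0 by rewrite /inv ifT.
pose k : fieldType := HB.pack Q (GRing.ComNzRing_isField.Build Q mulVq inv0).
pose phi : {rmorphism R -> k} := \pi_Q.
by exists k, phi; apply/eqP; rewrite piE.
Qed.

End ResidueField.

(** * Algebraic integers and their reduction modulo a prime *)

Definition algint := {x : algC | x \in Aint}.
HB.instance Definition _ := SubChoice.on algint.
HB.instance Definition _ := [SubChoice_isSubComNzRing of algint by <:].

(** The inverse of [p] would be a rational algebraic integer, hence an integer. So [p] is not a unit
    and vanishes in some residue field. *)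
Lemma algint_residue (p : nat) : prime p ->
  exists (k : fieldType) (phi : {rmorphism algint -> k}), p \in [pchar k].
Proof.
move=> p_pr; have [x|k [phi phi0]] := @residue_field algint p%:R.
  apply/eqP => /(congr1 val); rewrite rmorphM rmorph1 rmorph_nat => xp.
  have p0 : p%:R != 0 :> algC by rewrite pnatr_eq0 -lt0n prime_gt0.
  have : val x \in Num.int.
    apply: Cint_rat_Aint (valP x); have -> : val x = p%:R^-1.
      by apply: (mulIf p0); rewrite mulVf.
    by rewrite rpredV rpred_nat.
  case/intrP => m xm; have : m%:~R * p%:Z%:~R = 1 :> algC by rewrite -xm; exact: xp.
  rewrite -intrM => /eqP.
  rewrite (eqr_int _ _ 1) => /eqP mp.
  have : (p%:Z %| m * p%:Z)%Z by rewrite dvdz_mull.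
  by rewrite mp dvdz1 => /eqP; move: (prime_gt1 p_pr); case: (p) => [|[]].
exists k, phi; rewrite inE p_pr -(rmorph_nat phi); exact/eqP.
Qed.

Lemma normal_num_field_exists (x : algC) :
  exists (Qn : splittingFieldType rat) (QnC : {rmorphism Qn -> algC}) (y : Qn),
    QnC y = x.
Proof.
have [r Dr] := closed_field_poly_normal (minCpoly x).
rewrite (monicP (minCpoly_monic x)) scale1r in Dr.
have [Qs [QsC [s Ds gen_s]]] := num_field_exists r.
have [q [Dq _] _] := minCpolyP x.
have splitQs : splitting_field_axiom Qs.
  exists (map_poly ratr q).
    apply/polyOverP => i; rewrite coef_map_id0; last by rewrite -alg_num_field scale0r.
    have : ratr q`_i \in (1%VS : {vspace Qs}).
      by apply/vlineP; exists q`_i; rewrite alg_num_field.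
    by [].
  exists s => //; rewrite -(eqp_map QsC) -map_poly_comp.
  rewrite (eq_map_poly (fmorph_rat _)) -Dq Dr -Ds big_map rmorph_prod.
  by rewrite (eq_bigr _ (fun i _ => map_polyXsubC QsC i)) eqpxx.
pose Qn : splittingFieldType rat :=
  HB.pack Qs (FieldExt_isSplittingField.Build rat Qs splitQs).
exists Qn, QsC.
have : x \in r by rewrite -root_prod_XsubC -Dr root_minCpoly.
by rewrite -Ds => /mapP[y _ ->]; exists y.
Qed.

(** [x] comes from a Galois extension of the rationals whose automorphisms all extend to [algC];
    hence it lies in the fixed field of the Galois group. *)
Lemma Crat_fixed_by_aut (x : algC) :
  (forall nu : {rmorphism algC -> algC}, nu x = x) -> x \in Crat.
Proof.
move=> fix_x; have [Qn [QnC [y Dy]]] := normal_num_field_exists x.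
have galQn : galois 1 {:Qn}.
  rewrite /galois sub1v normalFieldf andbT.
  apply/separableP => z _; apply: pcharf0_separable => p.
  by rewrite -(fmorph_pchar QnC) pchar_num.
have : y \in fixedField 'Gal({:Qn} / 1)%g.
  apply/fixedFieldP => [|g _]; first exact: memvf.
  have [nu Dnu] := extend_algC_subfield_aut QnC (g : {rmorphism Qn -> Qn}).
  by apply: (fmorph_inj QnC); rewrite Dnu Dy fix_x.
rewrite (galois_fixedField galQn) => /vlineP[a Da].
by rewrite -Dy Da alg_num_field fmorph_rat Crat_rat.
Qed.

(** Packs a tuple into one element, so that one root of the resolvent below yields a permutation
    valid for all indices at once. *)
Definition gen_poly (R : nzRingType) n (c : 'I_n -> R) : {poly R} :=
  \sum_i c i *: 'X^i.

Lemma coef_gen_poly (R : nzRingType) n (c : 'I_n -> R) (i : 'I_n) : (gen_poly c)`_i = c i.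
Proof.
rewrite coef_sum (bigD1 i) //= coefZ coefXn eqxx mulr1 big1 ?addr0 // => j ji.
by rewrite coefZ coefXn eq_sym (inj_eq val_inj) (negPf ji) mulr0.
Qed.

Lemma eq_gen_poly (R : nzRingType) n (c d : 'I_n -> R) :
  c =1 d -> gen_poly c = gen_poly d.
Proof. by move=> cd; apply: eq_bigr => i _; rewrite cd. Qed.

Lemma map_gen_poly (R S : nzRingType) (f : {rmorphism R -> S}) n (c : 'I_n -> R) :
  map_poly f (gen_poly c) = gen_poly (f \o c).
Proof. by rewrite rmorph_sum; apply: eq_bigr => i _ /=; rewrite map_polyZ map_polyXn. Qed.

(** A Galois resolvent whose weights are the powers of an indeterminate. Translation in [G] permutes
    the factors, so permuting the tuple by [G] leaves it unchanged. *)
Definition resolvent (R : comNzRingType) n (c : 'I_n -> R) (G : {group 'S_n}) :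
  {poly {poly R}} := \prod_(s in G) ('X - (gen_poly (c \o s))%:P).

Lemma map_resolvent (R S : comNzRingType) (f : {rmorphism R -> S}) n (c : 'I_n -> R) G :
  map_poly (map_poly f) (resolvent c G) = resolvent (f \o c) G.
Proof.
rewrite rmorph_prod; apply: eq_bigr => s _ /=.
by rewrite rmorphB /= map_polyX map_polyC /= map_gen_poly.
Qed.

Lemma resolventM (R : comNzRingType) n (c : 'I_n -> R) (G : {group 'S_n}) t :
  t \in G -> resolvent (c \o t) G = resolvent c G.
Proof.
move=> Gt; rewrite /resolvent [RHS](reindex_inj (mulIg t)) /=.
apply: eq_big => [s|s _]; first by rewrite groupMr.
by congr ('X - _%:P); apply: eq_gen_poly => i; rewrite /= permM.
Qed.

Lemma eq_resolvent (R : comNzRingType) n (c d : 'I_n -> R) (G : {group 'S_n}) :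
  c =1 d -> resolvent c G = resolvent d G.
Proof.
move=> cd; apply: eq_bigr => s _; congr ('X - _%:P).
by apply: eq_gen_poly => i; rewrite /= cd.
Qed.

(* The resolvent has coefficients in [int], so its image over [k] is fixed by the
   Frobenius map [F] on coefficients, which therefore sends the root
   [gen_poly (phi \o l)] to another root. *)
Lemma frobenius_perm n (l : 'I_n -> algint) (G : {group 'S_n}) (k : fieldType)
    (phi : {rmorphism algint -> k}) (p : nat) :
    p \in [pchar k] ->
    (forall nu : {rmorphism algC -> algC},
       exists2 t, t \in G & forall i, nu (val (l i)) = val (l (t i))) ->
  exists2 s, s \in G & forall i, phi (l (s i)) = phi (l i) ^+ p.
Proof.
move=> charp autG; pose h := resolvent l G.
have h_int i j : exists z : int, h`_i`_j = z%:~R.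
  (* An automorphism acts on the tuple through [G], so it fixes this coefficient, which is thus a
     rational algebraic integer. *)
  have : val h`_i`_j \in Num.int.
    apply: Cint_rat_Aint (valP _); apply: Crat_fixed_by_aut => nu.
    have coef_h (f : {rmorphism algint -> algC}) :
      f h`_i`_j = (resolvent (f \o l) G)`_i`_j by rewrite -map_resolvent !coef_map.
    pose v : {rmorphism algint -> algC} := val.
    pose nv : {rmorphism algint -> algC} := (nu \o val)%FUN.
    rewrite -[LHS]/(nv _) -[RHS]/(v _) !coef_h.
    have [t Gt nul] := autG nu.
    by rewrite (@eq_resolvent _ _ (nv \o l) ((v \o l) \o t)) ?resolventM.
  by case/intrP => z hz; exists z; apply: val_inj; rewrite hz rmorph_int.
pose F : {rmorphism k -> k} := pFrobenius_aut charp.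
have hkF : map_poly (map_poly F) (resolvent (phi \o l) G) = resolvent (phi \o l) G.
  apply/polyP => i; apply/polyP => j; rewrite !coef_map -map_resolvent !coef_map.
  by have [z /= ->] := h_int i j; rewrite !rmorph_int.
have : (resolvent (phi \o l) G).[gen_poly (phi \o l)] = 0.
  rewrite horner_prod (bigD1 1%g) //= hornerXsubC.
  rewrite (@eq_gen_poly _ _ ((phi \o l) \o (1%g : 'S_n)) (phi \o l)) ?subrr ?mul0r // => i.
  by rewrite /= perm1.
move/(congr1 (map_poly F)); rewrite -horner_map hkF rmorph0 /= map_gen_poly.
rewrite horner_prod => /eqP/prodf_eq0[s Gs].
rewrite hornerXsubC subr_eq0 => /eqP E; exists s => // i.
by move/(congr1 (fun q : {poly k} => q`_i)): E; rewrite !coef_gen_poly.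
Qed.

(** * Radical numbers *)

Local Notation autC := {rmorphism algC -> algC}.

(* The [k]-th derived subgroup of the automorphism group, closed under
   conjugation by [Num.conj_op] so that the numbers it fixes are stable under
   complex conjugation. *)
Inductive derived_aut : nat -> autC -> Prop :=
| DerivedAut0 u : derived_aut 0 u
| DerivedAutR k u v : derived_aut k u -> derived_aut k v ->
    derived_aut k.+1 (u \o v \o algC_invaut u \o algC_invaut v)
| DerivedAutM k u v : derived_aut k u -> derived_aut k v -> derived_aut k (u \o v)
| DerivedAutC k u : derived_aut k u -> derived_aut k (Num.conj_op \o u \o Num.conj_op).

(** Commutators act trivially on [P] once level [k] commutes on [P] and its inverses preserve [P];
    products and complex conjugates of automorphisms fixing [P] fix it as well. *)
Lemma derived_aut_fix k (P : algC -> Prop) :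
    (forall x, P x -> P x^*) ->
    (forall u, derived_aut k u -> forall x, P x -> P (algC_invaut u x)) ->
    (forall u v, derived_aut k u -> derived_aut k v ->
       forall x, P x -> u (v x) = v (u x)) ->
  forall u, derived_aut k.+1 u -> forall x, P x -> u x = x.
Proof.
move=> PC PV Pcomm u; move Dm: k.+1 => m Du; elim: Du Dm => //= {m u}.
- move=> m u v Du _ Dv _ [Dm] x Px; rewrite -{m}Dm in Du Dv.
  by rewrite Pcomm ?algC_invautK //; apply: (PV) => //; apply: PV.
- by move=> m u v _ IHu _ IHv Dm x Px; rewrite /= IHv ?IHu.
- by move=> m u _ IHu Dm x Px; rewrite /= IHu ?conjCK //; apply: PC.
Qed.

Definition derived_fixed k (x : algC) := forall u, derived_aut k u -> u x = x.

Lemma derived_fixed_conj k x : derived_fixed k x -> derived_fixed k x^*.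
Proof. by move=> fx u /DerivedAutC/fx /= ux; rewrite -[LHS]conjCK ux. Qed.

Lemma derived_fixed_inv k x u :
  derived_fixed k x -> derived_aut k u -> algC_invaut u x = x.
Proof. by move=> fx /fx ux; rewrite -{1}ux algC_autK. Qed.

Lemma derived_fixedS k x : derived_fixed k x -> derived_fixed k.+1 x.
Proof.
move=> fx u /derived_aut_fix; apply; last exact: fx.
- exact: derived_fixed_conj.
- by move=> v Dv y fy; rewrite (derived_fixed_inv fy).
- by move=> v w Dv Dw y fy; rewrite (fy w) // (fy v) // fy.
Qed.

Lemma derived_fixed_le k m x : (k <= m)%N -> derived_fixed k x -> derived_fixed m x.
Proof.
by move=> /subnK <-; elim: (m - k)%N => // d IHd fx; apply/derived_fixedS/IHd.
Qed.

(** Every automorphism raises a primitive root of unity to some power, and taking powers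
    commutes. *)
Lemma derived_fixed_unity_root k n z : (0 < n)%N -> z ^+ n = 1 -> derived_fixed k.+1 z.
Proof.
move=> n_gt0 zn u /(derived_aut_fix (P := fun z => z ^+ n = 1)); apply=> //.
- by move=> x xn; rewrite -rmorphXn xn rmorph1.
- by move=> v _ x xn; rewrite -rmorphXn xn rmorph1.
have [w prim_w] := C_prim_root_exists n_gt0 => {zn z}.
have wpow (v : autC) : exists a, v w = w ^+ a.
  have [|a ->] := prim_rootP prim_w (x := v w); last by exists a.
  by rewrite -rmorphXn (prim_expr_order prim_w) rmorph1.
move=> v1 v2 _ _ _ /(prim_rootP prim_w)[i ->].
have [[a va] [b vb]] := (wpow v1, wpow v2).
by rewrite !(rmorphXn, va, vb) -!exprM; congr (w ^+ _); rewrite !mulnA (mulnC a b).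
Qed.

(** A Kummer argument: a level [k.+1] automorphism multiplies an [n]-th root of a fixed number by a
    root of unity, itself fixed at that level. So two such automorphisms commute on the root. *)
Lemma derived_fixed_root k n x :
  (0 < n)%N -> derived_fixed k (x ^+ n) -> derived_fixed k.+2 x.
Proof.
move=> n_gt0 fxn u /(derived_aut_fix (P := fun y => derived_fixed k (y ^+ n))); apply=> //.
- by move=> y fy; rewrite -rmorphXn; apply: derived_fixed_conj.
- move=> v Dv y fy; rewrite -rmorphXn /= (derived_fixed_inv _ Dv) //.
  exact: derived_fixedS.
move=> v1 v2 D1 D2 y fy; have [->|y0] := eqVneq y 0; first by rewrite !rmorph0.
have vy (v : autC) : derived_aut k.+1 v ->
    exists2 c, derived_fixed k.+1 c & v y = c * y.
  move=> Dv; exists (v y / y); last by rewrite divfK.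
  apply: (derived_fixed_unity_root n_gt0).
  by rewrite exprMn exprVn -rmorphXn (derived_fixedS fy Dv) divff ?expf_neq0.
have [[c1 fc1 E1] [c2 fc2 E2]] := (vy _ D1, vy _ D2).
by rewrite E1 E2 !rmorphM (fc2 v1) // (fc1 v2) // E1 E2 mulrCA.
Qed.

(** Invariance under some level of the derived series stands in for an explicit tower of
    radicals. *)
Definition radical_number x := exists k, derived_fixed k x.

Lemma radical_number2 x y : radical_number x -> radical_number y ->
  exists k, derived_fixed k x /\ derived_fixed k y.
Proof.
move=> [k fx] [m fy]; exists (maxn k m).
by split; [apply: derived_fixed_le fx; rewrite leq_maxl
          |apply: derived_fixed_le fy; rewrite leq_maxr].
Qed.

Lemma radical_number_rat (a : rat) : radical_number (ratr a).
Proof. by exists 0 => u _; rewrite fmorph_rat. Qed.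

Lemma radical_number_int (z : int) : radical_number z%:~R.
Proof. by exists 0 => u _; rewrite rmorph_int. Qed.

Lemma radical_number_arith o x y :
  radical_number x -> radical_number y -> radical_number (arith_val o x y).
Proof.
move=> rx ry; have [k [fx fy]] := radical_number2 rx ry; exists k => u Du.
by case: o; rewrite /= ?rmorphB ?rmorphD ?fmorph_div ?rmorphM fx ?fy.
Qed.

Lemma radical_number_conj x : radical_number x -> radical_number x^*.
Proof. by move=> [k fx]; exists k; apply: derived_fixed_conj. Qed.

Lemma radical_number_root n x :
  (0 < n)%N -> radical_number (x ^+ n) -> radical_number x.
Proof. by move=> n_gt0 [k fx]; exists k.+2; apply: derived_fixed_root fx. Qed.

Lemma rt_eval_radical t (vs : seq algC) :
  (forall i, radical_number vs`_i) ->
  forall p, p \in rt_eval vs t -> radical_number p.1 /\ radical_number p.2.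
Proof.
have rcons_rad us x : (forall i, radical_number us`_i) -> radical_number x ->
    forall i, radical_number (rcons us x)`_i.
  (* An index beyond the list reads the default value 0, a radical number. *)
  move=> rus rx i; rewrite nth_rcons; case: ifP => // _; case: ifP => // _.
  exact: (radical_number_int 0).
elim: t vs => [out|o a b t IHt|k a t IHt|a t IHt|a t1 IH1 t2 IH2] vs rvs /=.
- by move=> p /mapP[q _ ->]; split; apply: rvs.
- apply/IHt/rcons_rad/radical_number_arith => //.
    by case: a => [z|a] /=; [exact: radical_number_int|exact: rvs].
  by case: b => [z|b] /=; [exact: radical_number_int|exact: rvs].
- by apply/IHt/rcons_rad => //; apply: (@radical_number_root k.+1) => //; rewrite rootCK.
- by apply/IHt/rcons_rad/radical_number_conj.
- by case: ifP => _; [apply: IH1|apply: IH2].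
Qed.

(** * Permutations of the eigenvalues induced by automorphisms *)

Section DerivedPermutations.
Variables (n : nat) (lam : 'I_n -> algC) (G : {group 'S_n}).

Definition induces (u : autC) (s : 'S_n) := forall i, u (lam i) = lam (s i).

(** Products of permutations apply the left factor first, compositions the right one; hence the
    reversed order. *)
Lemma inducesM u v s t : induces u s -> induces v t -> induces (u \o v) (t * s)%g.
Proof. by move=> us vt i; rewrite /= vt us permM. Qed.

Lemma inducesV u s : induces u s -> induces (algC_invaut u) s^-1%g.
Proof. by move=> us i /=; rewrite -{1}(permKV s i) -us algC_autK. Qed.

Hypothesis G_aut : forall s, s \in G -> exists u, induces u s.

(** The permutations induced at level [k.+1] form a group that contains the commutators of those
    obtained at level [k], hence the next derived subgroup. *)
Lemma derived_aut_induces k s : s \in (G^`(k))%g -> exists2 u, derived_aut k u & induces u s.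
Proof.
elim: k s => [|k IHk] s.
  by rewrite derg0 => /G_aut[u us]; exists u => //; apply: DerivedAut0.
pose H := [set t | `[< exists2 u, derived_aut k.+1 u & induces u t >]].
have inH t u : derived_aut k.+1 u -> induces u t -> t \in H.
  by move=> Du ut; rewrite inE; apply/asboolP; exists u.
have gH : group_set H.
  apply/group_setP; split=> [|a b].
    have [u Du u1] := IHk 1%g (group1 _).
    apply: (inH _ _ (DerivedAutR Du Du)) => i.
    by rewrite /= !algC_invautK perm1.
  rewrite !inE => /asboolP[u Du ua] /asboolP[v Dv vb].
  by apply/asboolP; exists (v \o u); [apply: DerivedAutM|apply: inducesM].
suff sub : (G^`(k.+1) \subset Group gH)%g by move/(subsetP sub); rewrite inE => /asboolP.
rewrite dergSn gen_subG; apply/subsetP => _ /imset2P[a b /IHk[u Du ua] /IHk[v Dv vb] ->].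
apply: (inH _ _ (DerivedAutR Dv Du)); rewrite commgEl conjgE.
by do !apply: inducesM => //; apply: inducesV.
Qed.

End DerivedPermutations.

(** * Eigenvalues of integer matrices *)

Local Notation mxC := (map_mx (intr : int -> algC)).

(** [x] is a root of a monic integer polynomial. The transpose appears because [eigenvalue] is about
    row vectors. *)
Lemma Aint_eigenvalue n (A : 'M[int]_n) (v : 'cV[algC]_n) x :
  v != 0 -> mxC A *m v = x *: v -> x \in Aint.
Proof.
move=> v0 Av; apply: (@root_monic_Aint (char_poly (mxC A^T))).
- rewrite -eigenvalue_root_char; apply/eigenvalueP; exists v^T.
    by rewrite -matrix.map_trmx -trmx_mul Av linearZ.
  by rewrite -(inj_eq trmx_inj) trmxK trmx0.
- exact: char_poly_monic.
by rewrite -map_char_poly; apply/polyOverP => i; rewrite coef_map /= intr_int.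
Qed.

Section IntegerEigenbasis.
Variables (n : nat) (A : 'M[int]_n.+1) (U : 'M[algC]_n.+1) (lam : 'I_n.+1 -> algC).
Hypothesis unitU : U \in unitmx.
Hypothesis eigU : forall k, mxC A *m col k U = lam k *: col k U.

Lemma col_eigenbasis_neq0 k : col k U != 0.
Proof.
apply/eqP => Uk0; have /(congr1 (fun M : 'M_n.+1 => M k k)) := mulVmx unitU.
rewrite !mxE eqxx big1 => [/eqP|i _]; first by rewrite eq_sym oner_eq0.
by move/matrixP/(_ i 0): Uk0; rewrite !mxE => ->; rewrite mulr0.
Qed.

Lemma exp_eigenbasis m k : mxC (A ^+ m) *m col k U = lam k ^+ m *: col k U.
Proof.
elim: m => [|m IHm]; first by rewrite expr0 map_scalar_mx rmorph1 mul1mx scale1r.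
rewrite exprS -[_ * _]/(_ *m _) map_mxM -mulmxA IHm -scalemxAr eigU scalerA.
by rewrite exprSr.
Qed.

Lemma exp_eigenbasis_diag m : mxC (A ^+ m) = U *m diag_mx (\row_k lam k ^+ m) *m invmx U.
Proof.
suff <- : mxC (A ^+ m) *m U = U *m diag_mx (\row_k lam k ^+ m) by rewrite mulmxK.
apply/matrixP => i k; have /colP/(_ i) := exp_eigenbasis m k.
have -> : mxC (A ^+ m) *m col k U = col k (mxC (A ^+ m) *m U) by rewrite !colE mulmxA.
by rewrite mul_mx_diag [LHS]mxE => ->; rewrite !mxE mulrC.
Qed.

Lemma trace_eigenbasis m : (\tr (A ^+ m))%:~R = \sum_k lam k ^+ m :> algC.
Proof.
rewrite -trace_map_mx exp_eigenbasis_diag mxtrace_mulC mulmxA mulVmx // mul1mx.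
by rewrite mxtrace_diag; apply: eq_bigr => k _; rewrite mxE.
Qed.

Lemma eigenvalue_in_eigenbasis (v : 'cV[algC]_n.+1) x :
  v != 0 -> mxC A *m v = x *: v -> exists j, x = lam j.
Proof.
move=> v0 Av; pose y := invmx U *m v.
have y0 : y != 0.
  by apply: contraNneq v0 => y0; rewrite -(mulKVmx unitU v) -/y y0 mulmx0.
have /cV0Pn[j yj] := y0; exists j; apply: (mulIf yj).
have : diag_mx (\row_k lam k) *m y = x *: y.
  rewrite /y scalemxAr -Av -[A]expr1 exp_eigenbasis_diag !mulmxA mulVmx // mul1mx.
  by congr (diag_mx _ *m _ *m _); apply/rowP => k; rewrite !mxE expr1.
by move/colP/(_ j); rewrite mul_diag_mx !mxE => ->.
Qed.

Lemma Aint_eigenbasis k : lam k \in Aint.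
Proof. exact: Aint_eigenvalue (col_eigenbasis_neq0 k) (eigU k). Qed.

(** Applying [nu] entrywise leaves the integer matrix unchanged and sends an eigenvector for [lam i]
    to one for [nu (lam i)]. *)
Lemma aut_permutes_eigenvalues (nu : autC) :
  injective lam -> exists s : 'S_n.+1, induces lam nu s.
Proof.
move=> lam_inj; have step i : exists j, nu (lam i) == lam j.
  have [||j ->] := @eigenvalue_in_eigenbasis (map_mx nu (col i U)) (nu (lam i)).
  - by rewrite map_mx_eq0 col_eigenbasis_neq0.
  - rewrite -map_mxZ -eigU map_mxM; congr (_ *m _).
    by apply/matrixP => a b; rewrite !mxE rmorph_int.
  by exists j.
pose f i := xchoose (step i).
have fE i : nu (lam i) = lam (f i) by apply/eqP/(xchooseP (step i)).
have f_inj : injective f.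
  by move=> i j fij; apply/lam_inj/(fmorph_inj nu); rewrite !fE fij.
by exists (perm f_inj) => i; rewrite permE.
Qed.

Definition trace_form (R : pzRingType) m (M : 'M[R]_m.+1) : 'M[R]_m.+1 :=
  \matrix_(i, j) \tr (M ^+ (i + j)).

(* The determinant of the trace form is the squared Vandermonde determinant of the
   eigenvalues. *)
Lemma eigenvalues_injective p : prime p ->
  trace_form (map_mx (intr : int -> 'F_p) A) \in unitmx -> injective lam.
Proof.
move=> p_pr unitT i j lij; apply: contraTeq unitT => ij.
have detV : \det (Vandermonde n.+1 (\row_k lam k)) = 0.
  rewrite det_Vandermonde; apply/eqP; rewrite prodf_seq_eq0.
  wlog ltij : i j lij ij / (i < j)%N.
    move=> wl; move: (ij); rewrite neq_ltn => /orP[|ji]; first exact: wl.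
    by apply: (wl j i) => //; rewrite eq_sym.
  apply/hasP; exists i; rewrite ?mem_index_enum //=; apply/prodf_eq0.
  by exists j => //; rewrite !mxE lij subrr.
have VVT : Vandermonde n.+1 (\row_k lam k) *m (Vandermonde n.+1 (\row_k lam k))^T
   = mxC (trace_form A).
  apply/matrixP => a b; rewrite !mxE trace_eigenbasis; apply: eq_bigr => k _.
  by rewrite !mxE exprD.
have : \det (mxC (trace_form A)) = 0 by rewrite -VVT det_mulmx detV mul0r.
rewrite det_map_mx => /eqP; rewrite intr_eq0 => /eqP detT.
rewrite unitmxE.
suff -> : trace_form (map_mx (intr : int -> 'F_p) A) = map_mx intr (trace_form A).
  by rewrite det_map_mx detT rmorph0 unitr0.
by apply/matrixP => a b; rewrite !mxE -trace_map_mx rmorphXn.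
Qed.

End IntegerEigenbasis.

(** * The order of a Frobenius permutation *)

Lemma iter_gcdn (T : Type) (f : T -> T) (x : T) m n :
  iter m f x = x -> iter n f x = x -> iter (gcdn m n) f x = x.
Proof.
move=> fm fn; have mult a k : iter a f x = x -> iter (k * a) f x = x.
  by move=> fa; elim: k => [|k IHk] //; rewrite mulSn iterD IHk.
case: m fm => [|m] fm; first by rewrite gcd0n.
case: (@egcdnP m.+1 n) => // km kn E _.
by rewrite -[in LHS](mult n kn fn) -iterD addnC -E mult.
Qed.

Lemma iter_expr (R : pzRingType) p m (x : R) : iter m (fun y => y ^+ p) x = x ^+ (p ^ m).
Proof. by elim: m => //= m ->; rewrite -exprM -expnSr. Qed.

Section FrobeniusOrder.
Variables (n : nat) (A : 'M[int]_n.+1) (U : 'M[algC]_n.+1) (lam : 'I_n.+1 -> algC).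
Hypothesis unitU : U \in unitmx.
Hypothesis eigU : forall k, mxC A *m col k U = lam k *: col k U.
Variable G : {group 'S_n.+1}.
Hypothesis autG : forall nu : autC, exists2 t, t \in G & induces lam nu t.
Variables (p d : nat).
Hypothesis p_pr : prime p.
Local Notation Ap := (map_mx (intr : int -> 'F_p) A).
Hypothesis Ap_pow : Ap ^+ (p ^ d) = Ap.
Hypothesis Ap_trace : forall e, (e %| d)%N -> e != d ->
  exists j, \tr (Ap ^+ (p ^ e + j)) != \tr (Ap ^+ j.+1).

Let map_exp m : map_mx (intr : int -> 'F_p) (A ^+ m) = Ap ^+ m.
Proof. exact: rmorphXn. Qed.

(* If the order of [s] were not divisible by [d], all the residues of the
   eigenvalues would lie in the field with [p ^ e] elements for a proper divisor
   [e] of [d], against [Ap_trace]. *)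
Lemma frobenius_order : exists2 s, s \in G & (d %| #[s]%g)%N.
Proof.
have [k [phi charp]] := algint_residue p_pr.
pose l i : algint := exist _ (lam i) (Aint_eigenbasis unitU eigU i).
have [s Gs ls] := frobenius_perm (l := l) (G := G) phi charp autG.
exists s => //; pose F (x : k) := x ^+ p.
have fix_d i : iter d F (phi (l i)) = phi (l i).
  (* By [Ap_pow], [A ^+ (p ^ d)] and [A] differ by [p] times an integer matrix [E]. The eigenvectors
     of [A] are eigenvectors of [E], so [(lam i ^+ (p ^ d) - lam i) / p] is an algebraic integer,
     and the numerator vanishes under [phi]. *)
  have [E defE] : exists E : 'M[int]_n.+1, A ^+ (p ^ d) = A + p%:Z *: E.
    have dvd a b : exists q : int, (A ^+ (p ^ d) - A) a b = q * p%:Z.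
      apply/dvdzP; rewrite (dvdz_pcharf (pchar_Fp p_pr)).
      have /matrixP/(_ a b) := map_exp (p ^ d).
      by rewrite Ap_pow !mxE rmorphB /= => ->; rewrite subrr.
    exists (\matrix_(a, b) sval (cid (dvd a b))); apply/matrixP => a b.
    by rewrite !mxE; case: cid => q /=; rewrite !mxE mulrC => <-; rewrite addrC subrK.
  have p0 : p%:R != 0 :> algC by rewrite pnatr_eq0 -lt0n prime_gt0.
  have intc : (lam i ^+ (p ^ d) - lam i) / p%:R \in Aint.
    apply: (Aint_eigenvalue (A := E) (col_eigenbasis_neq0 unitU i)).
    apply: (scalerI p0); rewrite scalerA mulrCA divff // mulr1 scalerBl.
    rewrite -(exp_eigenbasis eigU) -eigU defE -mulmxBl scalemxAl; congr (_ *m _).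
    by apply/matrixP => a b; rewrite !mxE rmorphD rmorphM /= addrC addKr.
  pose c : algint := exist (fun x : algC => x \in Aint) _ intc.
  rewrite iter_expr -rmorphXn /=; apply/eqP; rewrite -subr_eq0 -rmorphB.
  have -> : l i ^+ (p ^ d) - l i = c * p%:R.
    by apply: val_inj; rewrite rmorphB rmorphM rmorphXn rmorph_nat /= divfK.
  by rewrite rmorphM rmorph_nat (pcharf0 charp) mulr0.
have fix_s i : iter #[s]%g F (phi (l i)) = phi (l i).
  have step m : iter m F (phi (l i)) = phi (l ((s ^+ m)%g i)).
    elim: m => [|m IHm]; first by rewrite expg0 perm1.
    by rewrite iterS IHm expgSr permM ls.
  by rewrite step expg_order perm1.
have fix_gcd i := iter_gcdn (fix_d i) (fix_s i).
apply: contraT => nds; have [||j] := @Ap_trace (gcdn d #[s]%g).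
- exact: dvdn_gcdl.
- by apply: contraNneq nds => <-; apply: dvdn_gcdr.
case/eqP; set e := gcdn _ _ in fix_gcd *.
rewrite -!map_exp !trace_map_mx; apply/eqP; rewrite -subr_eq0 -rmorphB.
(* An integer vanishes in ['F_p] exactly when it vanishes in [k], where traces become power sums of
   the residues. *)
rewrite -(dvdz_pcharf (pchar_Fp p_pr)) (dvdz_pcharf charp) rmorphB /= subr_eq0.
have trk m : (\tr (A ^+ m))%:~R = \sum_i phi (l i) ^+ m.
  rewrite -(rmorph_int phi); under eq_bigr => i _ do rewrite -rmorphXn.
  rewrite -rmorph_sum; congr (phi _); apply: val_inj.
  rewrite rmorph_int (trace_eigenbasis unitU eigU) rmorph_sum.
  by apply: eq_bigr => i _; rewrite rmorphXn.
rewrite !trk; apply/eqP/eq_bigr => i _.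
by rewrite exprD exprS -iter_expr fix_gcd.
Qed.

End FrobeniusOrder.

Lemma radical_eigenvalue_unique (A : 'M[int]_9) (U : 'M[algC]_9) (lam : 'I_9 -> algC) :
    U \in unitmx -> (forall k, mxC A *m col k U = lam k *: col k U) ->
    injective lam ->
    (map_mx (intr : int -> 'F_5) A) ^+ (5 ^ 7) = map_mx intr A ->
    (forall e, (e %| 7)%N -> e != 7 -> exists j,
       \tr ((map_mx (intr : int -> 'F_5) A) ^+ (5 ^ e + j))
         != \tr ((map_mx (intr : int -> 'F_5) A) ^+ j.+1)) ->
    (map_mx (intr : int -> 'F_7) A) ^+ (7 ^ 15) = map_mx intr A ->
    (forall e, (e %| 15)%N -> e != 15 -> exists j,
       \tr ((map_mx (intr : int -> 'F_7) A) ^+ (7 ^ e + j))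
         != \tr ((map_mx (intr : int -> 'F_7) A) ^+ j.+1)) ->
  forall r s, radical_number (lam r) -> radical_number (lam s) -> r = s.
Proof.
move=> unitU eigU lam_inj pow5 tr5 pow7 tr7 a b rada radb.
apply: contraTeq (isT : true) => ab.
pose G := [set s : 'S_9 | `[< exists nu : autC, induces lam nu s >]].
have gG : group_set G.
  apply/group_setP; split=> [|s t]; rewrite !inE.
    by apply/asboolP; exists idfun => i; rewrite perm1.
  move=> /asboolP[u us] /asboolP[v vt]; apply/asboolP.
  by exists (v \o u); apply: inducesM.
pose gpG := Group gG.
have Gaut s : s \in gpG -> exists u, induces lam u s by rewrite inE => /asboolP.
have autG (nu : autC) : exists2 t, t \in gpG & induces lam nu t.
  have [t nut] := aut_permutes_eigenvalues unitU eigU nu lam_inj.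
  by exists t => //; rewrite inE; apply/asboolP; exists nu.
have [s Gs s7] := frobenius_order unitU eigU autG (isT : prime 5) pow5 tr5.
have [t Gt t15] := frobenius_order unitU eigU autG (isT : prime 7) pow7 tr7.
have [k [fa fb]] := radical_number2 rada radb.
have Gk1 : (gpG^`(k))%g = 1%g.
  (* Elements of this derived subgroup are induced by automorphisms fixing both eigenvalues, so by
     injectivity of [lam] they fix both indices. *)
  apply: (normal_fix2_trivial (G := gpG) (N := [group of (gpG^`(k))%g]) Gs Gt s7 t15 _ ab).
    exact: der_normal.
  move=> u /(derived_aut_induces Gaut)[nu Dnu nuu].
  by split; apply: lam_inj; rewrite -nuu ?fa ?fb.
have /negP[] := not_solvable_order35 Gs Gt s7 t15.
by apply/derivedP; exists k; rewrite Gk1.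
Qed.

(** * The graph *)

(** Lists of natural numbers represent the matrices, so that [vm_compute] can evaluate products
    modulo a prime. *)
Definition nmx (R : pzRingType) n (f : seq (seq nat)) : 'M[R]_n :=
  \matrix_(i, j) (nth 0 (nth [::] f i) j)%:R.

Definition tabulate n (f : nat -> nat -> nat) : seq (seq nat) :=
  mkseq (fun i => mkseq (f i) n) n.

Definition ent (a : seq (seq nat)) i j := nth 0%N (nth [::] a i) j.

Definition mulmod p n (a b : seq (seq nat)) :=
  tabulate n (fun i j => sumn (mkseq (fun k => ent a i k * ent b k j)%N n) %% p)%N.

Definition trmod p n (a : seq (seq nat)) := (sumn (mkseq (fun i => ent a i i) n) %% p)%N.

Fixpoint powmod p n (a : seq (seq nat)) (m : nat) :=
  if m is m'.+1 then mulmod p n (powmod p n a m') a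
  else tabulate n (fun i j => (i == j : nat)).

(** Iterating the [p]-th power makes the exponent [p ^ m] reachable with [p * m] products; the
    largest one used is [7 ^ 15]. *)
Fixpoint frobmod p n (a : seq (seq nat)) (m : nat) :=
  if m is m'.+1 then powmod p n (frobmod p n a m') p else a.

Section ModularMatrices.
Variables (R : nzRingType) (p n : nat).
Hypothesis charp : p \in [pchar R].

Lemma ent_tabulate f (i j : 'I_n) : ent (tabulate n f) i j = f i j.
Proof. by rewrite /ent !nth_mkseq. Qed.

Lemma natr_modp m : (m %% p)%:R = m%:R :> R.
Proof. by rewrite [in RHS](divn_eq m p) natrD natrM (pcharf0 charp) mulr0 add0r. Qed.

Lemma sumn_mkseq (f : nat -> nat) : (sumn (mkseq f n))%:R = \sum_(i < n) (f i)%:R :> R.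
Proof. by rewrite sumnE big_map -{1}[n]subn0 big_mkord natr_sum. Qed.

Lemma nmx_mulmod a b : nmx R n (mulmod p n a b) = nmx R n a *m nmx R n b.
Proof.
apply/matrixP => i j; rewrite !mxE -/(ent _ i j) ent_tabulate natr_modp sumn_mkseq.
by apply: eq_bigr => k _; rewrite !mxE natrM.
Qed.

Lemma tr_nmx a : \tr (nmx R n a) = (trmod p n a)%:R.
Proof. by rewrite natr_modp sumn_mkseq; apply: eq_bigr => k _; rewrite !mxE. Qed.

End ModularMatrices.

Lemma nmx_powmod (R : nzRingType) p n (charp : p \in [pchar R]) a m :
  nmx R n.+1 (powmod p n.+1 a m) = nmx R n.+1 a ^+ m.
Proof.
elim: m => [|m IHm]; last by rewrite exprSr /= (nmx_mulmod _ charp) IHm.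
by apply/matrixP => i j; rewrite !mxE -/(ent _ i j) ent_tabulate.
Qed.

Lemma nmx_frobmod (R : nzRingType) p n (charp : p \in [pchar R]) a m :
  nmx R n.+1 (frobmod p n.+1 a m) = nmx R n.+1 a ^+ (p ^ m).
Proof.
elim: m => [|m IHm] /=; first by rewrite expr1.
by rewrite (nmx_powmod _ charp) IHm -exprM -expnSr.
Qed.

(** * The Laplacian of the graph modulo 5 and 7 *)

Definition adj9 (i j : nat) : bool :=
  [|| i == j.+1, j == i.+1, (i == 5) && (j == 7) | (i == 7) && (j == 5)].

(** The factor [p.-1] represents -1 modulo [p]. *)
Definition lap9 p : seq (seq nat) :=
  tabulate 9 (fun i j => ((i == j) * sumn (mkseq (fun k => adj9 i k : nat) 9)
                          + p.-1 * adj9 i j) %% p)%N.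


Definition degree_int n (e : rel 'I_n) : 'M[int]_n :=
  diag_mx (\row_i (\sum_j e i j)%N%:R).

Definition laplacian_int n (e : rel 'I_n) : 'M[int]_n :=
  degree_int e - \matrix_(i, j) (e i j : nat)%:R.

Lemma degree_mx_int n (e : rel 'I_n) : degree_mx e = mxC (degree_int e).
Proof.
rewrite /degree_int map_diag_mx; congr diag_mx; apply/rowP => i.
rewrite !mxE /= natz -pmulrn.
by rewrite -sum1dep_card big_mkcond; congr _%:R; apply: eq_bigr => j _; case: (e i j).
Qed.

Lemma laplacian_mx_int n (e : rel 'I_n) : laplacian e = mxC (laplacian_int e).
Proof.
rewrite /laplacian degree_mx_int map_mxB; congr (_ - _).
by apply/matrixP => i j; rewrite !mxE /= natz -pmulrn.
Qed.

Definition graph9 : rel 'I_9 := fun i j => adj9 i j.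

Lemma nmx_lap9 p : prime p -> map_mx intr (laplacian_int graph9) = nmx 'F_p 9 (lap9 p).
Proof.
move=> p_pr; have charp := pchar_Fp p_pr.
apply/matrixP => i j; rewrite !mxE -/(ent _ i j) ent_tabulate (natr_modp charp).
rewrite natrD !natrM (sumn_mkseq _ 9) rmorphB /= !natz -!pmulrn; congr (_ + _).
  rewrite -val_eqE /=; case: eqP => [_|_]; last by rewrite mulr0n mul0r.
  by rewrite mulr1n mul1r -natr_sum.
rewrite -subn1 natrB ?prime_gt0 // (pcharf0 charp) sub0r mulN1r.
by [].
Qed.

(* The inverse of the trace form of the Laplacian modulo 5. *)
Definition cert9 := [:: [:: 1; 3; 3; 0; 3; 0; 4; 1; 3]; [:: 3; 3; 4; 0; 3; 3; 0; 1; 3];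
  [:: 3; 4; 2; 4; 2; 2; 3; 2; 4]; [:: 0; 0; 4; 3; 4; 0; 3; 4; 2]; [:: 3; 3; 2; 4; 4; 3; 1; 0; 4];
  [:: 0; 3; 2; 0; 3; 3; 0; 0; 0]; [:: 4; 0; 3; 3; 1; 0; 4; 1; 3]; [:: 1; 1; 2; 4; 0; 0; 1; 1; 0];
  [:: 3; 3; 4; 2; 4; 0; 3; 0; 4]]%N.

Lemma lap9_trace_form_unit : trace_form (nmx 'F_5 9 (lap9 5)) \in unitmx.
Proof.
have char5 : 5 \in [pchar 'F_5] by apply: pchar_Fp.
(* The sums [i + j] of two indices below 9 run from 0 to 16, hence 17 traces. *)
pose tr := mkseq (fun m => trmod 5 9 (powmod 5 9 (lap9 5) m)) 17.
pose t := tabulate 9 (fun i j => nth 0 tr (i + j))%N.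
have -> : trace_form (nmx 'F_5 9 (lap9 5)) = nmx 'F_5 9 t.
  apply/matrixP => i j; rewrite !mxE -/(ent _ i j) ent_tabulate.
  rewrite nth_mkseq; last by rewrite (leq_ltn_trans (leq_add (leq_ord i) (leq_ord j))).
  by rewrite -(nmx_powmod _ char5) (tr_nmx _ char5).
suff /mulmx1_unit[] : nmx 'F_5 9 cert9 *m nmx 'F_5 9 t = 1%:M by [].
rewrite -(nmx_mulmod _ char5) -[RHS](expr0 (nmx 'F_5 9 t)) -(nmx_powmod _ char5).
by congr (nmx _ _ _); apply/eqP; vm_compute.
Qed.

Lemma lap9_frob_trace p e : prime p ->
    trmod p 9 (mulmod p 9 (frobmod p 9 (lap9 p) e) (powmod p 9 (lap9 p) 8))
      != trmod p 9 (powmod p 9 (lap9 p) 9) ->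
  \tr (nmx 'F_p 9 (lap9 p) ^+ (p ^ e + 8)) != \tr (nmx 'F_p 9 (lap9 p) ^+ 9).
Proof.
move=> p_pr; have charp := pchar_Fp p_pr; apply: contraNN.
rewrite exprD -(nmx_frobmod _ charp) -!(nmx_powmod _ charp) -[_ * _]/(_ *m _).
rewrite -(nmx_mulmod _ charp) !(tr_nmx _ charp).
move/eqP/(congr1 val); rewrite /= !val_Fp_nat //; rewrite /trmod !modn_mod => ->.
by [].
Qed.

Lemma lap9_frob p d : prime p -> frobmod p 9 (lap9 p) d == lap9 p ->
  nmx 'F_p 9 (lap9 p) ^+ (p ^ d) = nmx 'F_p 9 (lap9 p).
Proof.
by move=> p_pr /eqP E; rewrite -(nmx_frobmod _ (pchar_Fp p_pr)) E.
Qed.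

(** * Spectral drawings with radical coordinates *)

Lemma radical_number_sum n (F : 'I_n -> algC) :
  (forall i, radical_number (F i)) -> radical_number (\sum_i F i).
Proof.
move=> radF; elim/big_ind: _ => // [|x y]; first exact: (radical_number_int 0).
exact: (@radical_number_arith OpAdd).
Qed.

(** Scaling by the integer [b] keeps the eigenvectors and makes the matrix integral and congruent to
    the Laplacian modulo 35, so the computations modulo 5 and 7 apply to it. *)
Lemma spectral_drawing_not_radical (M : 'M[algC]_9) (b : int) (C : 'M[int]_9) pos :
    b != 0 -> b%:~R *: M = mxC (laplacian_int graph9 + 35%:Z *: C) ->
    spectral_drawing M pos ->
  ~ (forall p, p \in pos -> radical_number p.1 /\ radical_number p.2).
Proof.
set A := _ + _ => b0 bM [U [lam [r [s [unitU [_ [_ [_ [eigM [rs ->]]]]]]]]]] radpos.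
have radU i : radical_number (U i r) /\ radical_number (U i s).
  by apply: (radpos (U i r, U i s)); apply/mapP; exists i; rewrite ?mem_enum.
pose mu k := b%:~R * lam k.
have eigU k : mxC A *m col k U = mu k *: col k U by rewrite -bM -scalemxAl eigM scalerA.
have radmu k : (forall i, radical_number (U i k)) -> radical_number (mu k).
  move=> radUk; have /cV0Pn[i] := col_eigenbasis_neq0 unitU k; rewrite mxE => Uik.
  (* Comparing both sides of the eigenvector equation at a nonzero coordinate expresses the
     eigenvalue through the eigenvector. *)
  have -> : mu k = (\sum_j mxC A i j * U j k) / U i k.
    apply: (mulIf Uik); rewrite divfK //.
    have /colP/(_ i) := eigU k; rewrite !mxE => <-.
    by apply: eq_bigr => j _; rewrite !mxE.
  apply: (@radical_number_arith OpDiv) => //; apply: radical_number_sum => j.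
  by apply: (@radical_number_arith OpMul) => //; rewrite mxE; apply: radical_number_int.
have mapA p : prime p -> (p %| 35)%N -> map_mx intr A = nmx 'F_p 9 (lap9 p).
  move=> p_pr p35; rewrite -nmx_lap9 // /A map_mxD map_mxZ.
  have p0 : 35%:~R = 0 :> 'F_p by apply/eqP; rewrite -(dvdz_pcharf (pchar_Fp p_pr)).
  by rewrite /= p0 scale0r addr0.
have mapA5 := mapA 5 isT isT; have mapA7 := mapA 7 isT isT.
have mu_inj : injective mu.
  by apply: (eigenvalues_injective unitU eigU (p := 5)); rewrite ?mapA5 ?lap9_trace_form_unit.
have : r = s; last by move/eqP; rewrite (negPf rs).
apply: (radical_eigenvalue_unique unitU eigU mu_inj); rewrite ?mapA5 ?mapA7.
- by apply: lap9_frob; vm_compute.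
- move=> e; rewrite dvdn_divisors // -[divisors 7]/[:: 1; 7]%N !inE => /orP[] /eqP-> // _.
  (* Evaluation shows that the shift 8 separates the two traces, here and in the three cases modulo
     7. *)
  by exists 8; apply: lap9_frob_trace; vm_compute.
- by apply: lap9_frob; vm_compute.
- move=> e; rewrite dvdn_divisors // -[divisors 15]/[:: 1; 3; 5; 15]%N !inE.
  by move=> /or4P[] /eqP-> // _; exists 8; apply: lap9_frob_trace; vm_compute.
- by apply: radmu => i; have [] := radU i.
- by apply: radmu => i; have [] := radU i.
Qed.

(** [c] exceeds [1 / (y - x)], so consecutive multiples of [N / (1 + N * c)] are less than [y - x]
    apart; [a] selects the first multiple beyond [x]. *)
Lemma exists_fraction_between (R : archiRealFieldType) (N : nat) (x y : R) :
  (0 < N)%N -> x < y -> exists (a : int) (c : nat),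
    x < N%:R * a%:~R / (1 + N%:R * c%:R) /\ N%:R * a%:~R / (1 + N%:R * c%:R) < y.
Proof.
rewrite -(ltr0n R) => N0 xy; have xy0 : 0 < y - x by rewrite subr_gt0.
pose c := (Num.truncn (y - x)^-1).+1; pose b : R := 1 + N%:R * c%:R.
have c0 : 0 <= c%:R :> R by rewrite ler0n.
have cxy : 1 < (y - x) * c%:R by rewrite mulrC -ltr_pdivrMr // mul1r truncnS_gt.
have b0 : 0 < b by rewrite /b; nra.
have gap : N%:R < (y - x) * b by rewrite /b; nra.
pose a := Num.floor (x * b / N%:R) + 1; exists a, c.
have : a%:~R - 1 <= x * b / N%:R < a%:~R.
  by apply/andP; split; [rewrite /a intrD addrK floor_le|exact: floorD1_gt].
rewrite ler_pdivlMr // ltr_pdivrMr // => /andP[aub alb].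
by rewrite ltr_pdivlMr // ltr_pdivrMr // -/b; split; nra.
Qed.

Theorem theorem6 :
  exists e : rel 'I_9,
    simple_graph e /\
    (forall t : rtree, ~ constructs_drawing (adj_input e) (laplacian e) t) /\
    (exists A : rat -> Prop, dense_in_Q A /\
       forall rho : rat, A rho ->
         forall t : rtree,
           ~ constructs_drawing (rcons (adj_input e) (ratr rho))
                                (relaxed_laplacian e rho) t).
Proof.
have rad_nth (vs : seq algC) : (forall x, x \in vs -> radical_number x) ->
    forall i, radical_number vs`_i.
  move=> radvs i; have [ltis|leis] := ltnP i (size vs); first exact/radvs/mem_nth.
  by rewrite nth_default //; apply: (radical_number_int 0).
have rad_adj x : x \in adj_input graph9 -> radical_number x.
  by case/allpairsP => ij [_ _ ->]; apply: (radical_number_int (Posz _)).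
exists graph9; split; last split.
- by split=> [i j|i]; rewrite /graph9 /adj9; case: i => [[|[|[|[|[|[|[|[|[|//]]]]]]]]] ?];
  try case: j => [[|[|[|[|[|[|[|[|[|//]]]]]]]]] ?].
(* The ordinary Laplacian is the case [b = 1], [C = 0]. *)
- move=> t /(@spectral_drawing_not_radical _ 1 0); apply=> //.
    by rewrite scale1r scaler0 addr0 laplacian_mx_int.
  by apply: rt_eval_radical; apply: rad_nth.
exists (fun rho => exists (a : int) (c : nat), rho = 35%:R * a%:~R / (1 + 35%:R * c%:R)).
split.
  move=> x y /(exists_fraction_between (isT : 0 < 35)%N)[a [c xzy]].
  by exists (35%:R * a%:~R / (1 + 35%:R * c%:R)); split; first by exists a, c.
move=> rho [a [c ->]] t.
pose b : rat := 1 + 35%:R * c%:R; have b0 : b != 0.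
  by rewrite /b -natrM -[1]/(1%:R) -natrD pnatr_eq0.
(* With rho equal to [35 * a / (1 + 35 * c)], [(1 + 35 * c) * (L - rho * D) = L + 35 * (c * L - a *
   D)]. *)
move/(@spectral_drawing_not_radical _ (1 + 35%:Z * c%:Z)
  (c%:Z *: laplacian_int graph9 - a *: degree_int graph9)); apply.
- by [].
- have bC : ratr b = (1 + 35%:Z * c%:Z)%:~R :> algC.
    by rewrite rmorphD rmorph1 rmorphM !rmorph_nat intrD intrM.
  have E : (1 + 35%:Z * c%:Z)%:~R * ratr (35%:R * a%:~R / b) = 35%:R * a%:~R :> algC.
    rewrite fmorph_div rmorphM rmorph_nat rmorph_int /= -bC mulrC divfK //.
    by rewrite fmorph_eq0.
  rewrite /relaxed_laplacian laplacian_mx_int degree_mx_int scalerBr scalerA E.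
  move: (laplacian_int _) (degree_int _) => L D; apply/matrixP => i j; rewrite !mxE.
  by rewrite /= !(intrD, intrM, intrB); ring.
apply: rt_eval_radical; apply: rad_nth => x; rewrite mem_rcons inE => /orP[/eqP->|/rad_adj//].
exact: radical_number_rat.
Qed.
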